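(* Let $(\Omega,\mathcal F,\mathbf P)$ be a probability space equipped with a metric $\mathrm{dist}(\cdot,\cdot)$ such that $\int_\Omega \mathrm{dist}^2(o,x)\,\mathbf P(dx)<\infty$ for some (hence every) $o\in\Omega$. Let $M\ge 1$, let $T_1,\dots,T_M$ be measure-preserving Markov operators on $(\Omega,\mathcal F,\mathbf P)$, and let $(\theta_1,\dots,\theta_M)$ be a probability vector. Assume that, for some numbers $\ell_1,\dots,\ell_M\ge 0$ and a constant $\kappa\in[0,1]$, the following hold: (i) (Sectional curvature) for each $1\le i\le M$ and all $x,y$ outside a null set, $$W_\infty\big(T_i^\star(x,\cdot),T_i^\star(y,\cdot)\big)\le \ell_i\,\mathrm{dist}(x,y);$$ (ii) (Average curvature) for all $x,y$ outside a null set, $$\sum_{i=1}^M\theta_i\,\ell_i\,W_1\big(T_i(x,\cdot),T_i(y,\cdot)\big)\le (1-\kappa)\,\mathrm{dist}(x,y);$$ (iii) (Regularity) for each $1\le i\le M$ and every $f\in L^\infty$, $\mathrm{Lip}(T_if)<\infty$. Then $$\forall f\in L\log L,\qquad \sum_{i=1}^M\theta_i\,\mathrm{Ent}(T_i^\star f)\le (1-\kappa)\,\mathrm{Ent}(f).$$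
   Context: $L^p=L^p(\Omega,\mathcal F,\mathbf P)$, and $\mathbf E$ is expectation with respect to $\mathbf P$. $L\log L$ is the set of measurable $f:\Omega\to\mathbb R_+$ with $\mathbf E[|f\log f|]<\infty$, and $\mathrm{Ent}(f)=\mathbf E[f\log f]-\mathbf E[f]\log\mathbf E[f]$. A transition kernel on $\Omega$ is a function $T:\Omega\times\mathcal F\to[0,1]$ such that $T(x,\cdot)$ is a probability measure for each $x$ and $T(\cdot,E)$ is measurable for each $E\in\mathcal F$. It is identified with the Markov operator $(Tf)(x)=\int_\Omega f(y)\,T(x,dy)$. It is measure-preserving if $\mathbf E[Tf]=\mathbf E[f]$ for all $f\in L^\infty$; $T$ then extends to a bounded operator on every $L^p$, $p\in[1,\infty]$. Its adjoint $T^\star$, characterized by $\mathbf E[(T^\star f)g]=\mathbf E[(Tg)f]$ for $f,g\in L^2$, is again a measure-preserving Markov operator, identified with a transition kernel $T^\star(x,\cdot)$; $T^\star f$ is well defined and in $L\log L$ for $f\in L\log L$. For probability measures $\mu,\nu$ on $\Omega$, $W_1(\mu,\nu)=\inf \mathbb E[\mathrm{dist}(X,Y)]$ and $W_\infty(\mu,\nu)=\inf\,\mathrm{ess\,sup}\,\mathrm{dist}(X,Y)$, the infima running over all random pairs $(X,Y)$ with marginals $X\sim\mu$, $Y\sim\nu$. A null set is an event $N\in\mathcal F$ with $\mathbf P(N)=0$. The essential Lipschitz constant of $f:\Omega\to\mathbb R$ is $$\mathrm{Lip}(f)=\inf_{N\text{ null}}\ \sup\Big\{\tfrac{|f(x)-f(y)|}{\mathrm{dist}(x,y)}: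 x,y\in\Omega\setminus N,\ x\neq y\Big\}.$$ *)

(* Defs.v *)
From HB Require Import structures.
From mathcomp Require Import all_boot all_order all_algebra.
From mathcomp Require Import all_classical all_reals all_analysis.
From mathcomp Require Import ess_sup_inf.
Set Implicit Arguments.
Unset Strict Implicit.
Unset Printing Implicit Defensive.
Import Order.TTheory GRing.Theory Num.Theory.
Import numFieldNormedType.Exports.

Local Open Scope classical_set_scope.
Local Open Scope ring_scope.
Local Open Scope ereal_scope.

(* A sigma-algebra and a metric on the same carrier.  No compatibility is built
   in: the sigma-algebra need not be the Borel one. *)
#[short(type="measurableMetricType")]
HB.structure Definition MeasurableMetric (d : measure_display)
  (R : numDomainType) := {T of Metric R T & Measurable d T}.

Section Operators.
Context d (Omega : measurableType d) (R : realType).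
Implicit Types (P : probability Omega R) (T S : R.-pker Omega ~> Omega)
  (f g : Omega -> R).

(* (T f)(x), set to a default value at the points x where the integral is
   infinite or undefined.  For T measure-preserving and f integrable these
   points form a null set. *)
Definition markov_op T f (x : Omega) : R := (\int[T x]_y f y)%R.

Definition measure_preserving P T : Prop :=
  forall f, f \in Lfun P +oo -> 'E_P[markov_op T f] = 'E_P[f].

(* The Markov operator of S is the adjoint in L^2(P) of that of T.  S is a
   kernel, i.e. a version of the adjoint, defined at every point. *)
Definition is_adjoint P T S : Prop :=
  forall f g, f \in Lfun P 2%:E -> g \in Lfun P 2%:E ->
  'E_P[fun x => (markov_op S f x * g x)%R] =
  'E_P[fun x => (markov_op T g x * f x)%R].

(* The convention 0 log 0 = 0 holds because ln 0 = 0 in the library. *)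
Definition LlogL P f : Prop :=
  [/\ measurable_fun [set: Omega] f, forall x, (0 <= f x)%R
    & 'E_P[fun x => `|f x * ln (f x)|%R] < +oo].

Definition Ent P f : \bar R :=
  'E_P[fun x => (f x * ln (f x))%R] -
  (fine 'E_P[f] * ln (fine 'E_P[f]))%:E.

Definition null_event P (N : set Omega) : Prop := measurable N /\ P N = 0.

End Operators.

Section Metric.
Context d (R : realType) (Omega : measurableMetricType d R).
Implicit Types (mu nu : {measure set Omega -> \bar R}).

Definition has_law d' (S : measurableType d') (Q : probability S R)
    (X : {mfun S >-> Omega}) mu : Prop :=
  forall A, measurable A -> distribution Q X A = mu A.

Definition W1 mu nu : \bar R :=
  ereal_inf [set r | exists (d' : measure_display) (S : measurableType d')
    (Q : probability S R) (X Y : {mfun S >-> Omega}),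
    [/\ has_law Q X mu, has_law Q Y nu
      & r = 'E_Q[fun w => mdist (X w) (Y w)]]].

Definition Winfty mu nu : \bar R :=
  ereal_inf [set r | exists (d' : measure_display) (S : measurableType d')
    (Q : probability S R) (X Y : {mfun S >-> Omega}),
    [/\ has_law Q X mu, has_law Q Y nu
      & r = ess_sup Q (fun w => (mdist (X w) (Y w))%:E)]].

(* The supremum is taken in [0, +oo], so that it is 0 (and not -oo) when the
   complement of N is a single point. *)
Definition Lip (P : probability Omega R) (f : Omega -> R) : \bar R :=
  ereal_inf [set maxe 0 (ereal_sup
      [set (`|f z.1 - f z.2| / mdist z.1 z.2)%:E | z in
        [set z : Omega * Omega | [/\ ~ N z.1, ~ N z.2 & z.1 <> z.2]]])
    | N in null_event P].

End Metric.

(* Main.v *)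
Require Import Defs.
From mathcomp Require Import all_boot all_order all_algebra.
From mathcomp Require Import all_classical all_reals all_analysis.
From mathcomp Require Import ess_sup_inf measurable_realfun lra.
Import Order.TTheory GRing.Theory Num.Theory.
Import numFieldNormedType.Exports.
Local Open Scope classical_set_scope.
Local Open Scope ring_scope.
Set Implicit Arguments.
Unset Strict Implicit.
Unset Printing Implicit Defensive.

(** Let [xlnx s = s ln s], let [S_i] denote the kernel adjoint to [T_i], and fix
    [lam > 1 - kappa].  For [f] bounded above and away from [0], consider

      [D f = lam (E (xlnx f) - xlnx (E f))
             - sum_i theta_i (E (xlnx (S_i f)) - xlnx (E f))].

    The theorem for such [f] is [D f >= 0], with [lam] decreasing to
    [1 - kappa].  As a function of [f] of given mean, [D] is a difference of two
    convex functionals, so it decreases when the subtracted one is replaced by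
    its tangent at [f] and the resulting convex functional is minimised.  By
    duality the slope of that tangent is [G f = sum_i theta_i T_i (ln (S_i f))]
    ([entropy_grad]); under the constraints [E g = E f] and [|ln g| <= a] the
    minimiser is [g = exp (clip (G f / lam - c))], where [clip] truncates to
    [[-a, a]] and [c] adjusts the mean ([clip_step], [clip_step_decr]).

    Curvature acts on the Lipschitz constants of logarithms.  If [ln f] is
    [L]-Lipschitz, coupling [S_i x] and [S_i y] at almost sure distance at most
    [ell_i dist(x, y)] shows that [ln (S_i f)] is [ell_i L]-Lipschitz
    ([essLip_ln_markov]).  Coupling [T_i x] and [T_i y] in mean and averaging
    over [i] then makes [G f] Lipschitz with constant [(1 - kappa) L]
    ([essLip_average]).  Hence [ln g] has Lipschitz constant [rho L], with
    [rho = (1 - kappa) / lam < 1].  The regularity hypothesis makes [G f]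
    Lipschitz for the initial [f], for which nothing else is known.

    Iterating this step gives functions [f_n] with the same mean as [f], with
    values in a fixed interval, with [D f_n <= D f], and whose logarithms have
    Lipschitz constants of order [rho ^ n].  Since the distance to a point is
    integrable, [f_n] converges in mean to the constant [E f], so the entropies
    of the [S_i f_n] tend to [0] ([output_entropy_le_Lip]), and the
    nonnegativity of the entropy of [f_n] (Jensen) gives [D f >= 0] in the limit
    ([box_contraction]).

    Minimising over a fixed interval is what makes the iteration converge.  The
    unconstrained minimiser is [exp (G f / lam - c)]; the oscillation of its
    logarithm may grow by a factor [1 / lam] at every step, and a moment of
    order two of the distance does not control exponentials of Lipschitz
    functions.

    A general [f] in [L log L] is truncated to [[1 / n, n]].  Both sides
    converge by dominated convergence; for [S_i f] a majorant is
    [S_i (2 + |xlnx f|)], by Jensen's inequality for each measure [S_i x]. *)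

(** * Real functions: s ln s and truncation *)
Section RealFunctions.
Context {R : realType}.
Implicit Types (a m r s u v : R).

Definition xlnx s : R := s * ln s.

(** The left-hand side is the tangent of the convex function [xlnx] at [r],
    arranged so that, for densities of equal mean, the term [s - r] integrates
    to [0] and only the product [s * ln r] remains. *)
Lemma xlnx_tangent r s : 0 < r -> 0 <= s -> s * ln r + (s - r) <= xlnx s.
Proof.
move=> r0; rewrite le_eqVlt /xlnx => /predU1P[<-|s0].
  by rewrite !mul0r; lra.
have rs0 : 0 < r / s by exact: divr_gt0.
have lnrs : ln (r / s) <= r / s - 1.
  have := expR_ge1Dx (ln (r / s)); rewrite lnK ?posrE//; lra.
rewrite ln_div ?posrE// in lnrs.
have := ler_wpM2l (ltW s0) lnrs.
rewrite !mulrBr mulrCA divff ?gt_eqF// !mulr1; lra.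
Qed.

Lemma xlnx_ge s : 0 <= s -> -1 <= xlnx s.
Proof. by move=> s0; have := xlnx_tangent ltr01 s0; rewrite ln1 mulr0; lra. Qed.

Lemma xlnx_le s : 0 <= s -> xlnx s <= s * (s - 1).
Proof.
rewrite /xlnx le_eqVlt => /predU1P[<-|s0]; first by rewrite !mul0r.
rewrite ler_pM2l//; have := expR_ge1Dx (ln s); rewrite lnK ?posrE//; lra.
Qed.

Lemma xlnx_cvg (s_ : nat -> R) s : (forall n, 0 <= s_ n) ->
  s_ @ \oo --> s -> xlnx \o s_ @ \oo --> xlnx s.
Proof.
move=> s_0 ss.
have : 0 <= s.
  rewrite -(cvg_lim _ ss)//; apply: limr_ge; first by apply/cvg_ex; exists s.
  exact: nearW.
rewrite le_eqVlt => /predU1P[s0|s0]; last first.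
  by apply: cvgM => //; apply: (continuous_cvg _ (continuous_ln s0) ss).
(* Near 0, [- x ln x] is at most [2 sqrt x]: apply [ln y <= y - 1] at
   [y = 1 / sqrt x]. *)
have bnd x : 0 <= x -> `|xlnx x| <= 2 * Num.sqrt x + x * x.
  rewrite le_eqVlt => /predU1P[<-|x0].
    by rewrite /xlnx mul0r normr0 sqrtr0; lra.
  set q := Num.sqrt x.
  have q0 : 0 < q by rewrite sqrtr_gt0.
  have xq : x = q * q by rewrite -expr2 sqr_sqrtr// ltW.
  have lnx : ln x = 2 * ln q by rewrite xq lnM ?posrE//; lra.
  have h1 : - ln q <= q^-1 - 1.
    have := expR_ge1Dx (ln q^-1); rewrite lnK ?posrE ?invr_gt0// lnV ?posrE//; lra.
  have h2 := xlnx_le (ltW x0).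
  have h3 : - xlnx x <= 2 * q.
    rewrite /xlnx lnx {1}xq.
    have : q * q * (- ln q) <= q * q * (q^-1 - 1).
      by rewrite ler_wpM2l// mulr_ge0 ?ltW.
    rewrite mulrBr -[q * q / q]mulrA divff ?gt_eqF// mulr1; nra.
  have q0' := ltW q0.
  by rewrite ler_norml; apply/andP; split; nra.
rewrite -s0 /xlnx mul0r; apply/norm_cvg0P.
apply: (squeeze_cvgr (f := cst 0) (h :=
  fun n => 2 * Num.sqrt (s_ n) + s_ n * s_ n)).
- by apply: nearW => n; rewrite normr_ge0/=; exact: bnd.
- exact: cvg_cst.
- rewrite -s0 in ss.
  have -> : 0 = 2 * Num.sqrt 0 + 0 * 0 :> R by rewrite sqrtr0; lra.
  apply: cvgD; last exact: cvgM.
  by apply: cvgMr; apply: continuous_cvg ss; exact: sqrt_continuous.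
Qed.

Definition clip a m := Num.max (- a) (Num.min a m).

Lemma clipP a m : 0 <= a ->
  [\/ clip a m = - a /\ m <= - a, clip a m = m /\ `|m| <= a
     | clip a m = a /\ a <= m].
Proof.
move=> a0; rewrite /clip.
have [am|ma] := leP a m.
  by apply: Or33; rewrite max_r//; lra.
have [am'|ma'] := leP (- a) m.
  by apply: Or32; split => //; rewrite ler_norml am' ltW.
by apply: Or31; split => //; exact: ltW.
Qed.

Lemma clip_bound a m : 0 <= a -> `|clip a m| <= a.
Proof.
move=> a0; case: (clipP m a0) => -[-> //]; rewrite ?normrN ger0_norm//.
Qed.

Lemma clip_dist a m r : 0 <= a -> `|clip a m - clip a r| <= `|m - r|.
Proof.
move=> a0; have n1 := ler_norm (m - r); have n2 := ler_norm (r - m).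
rewrite [`|r - m|]distrC in n2.
rewrite ler_norml; case: (clipP m a0) => -[-> hm]; case: (clipP r a0) => -[-> hr];
move: hm hr; rewrite ?ler_norml => hm hr; apply/andP; split; lra.
Qed.

Lemma clip_lo a m : 0 <= a -> m <= - a -> clip a m = - a.
Proof.
by move=> a0 ma; case: (clipP m a0) => -[-> //]; rewrite ?ler_norml; lra.
Qed.

Lemma clip_hi a m : 0 <= a -> a <= m -> clip a m = a.
Proof.
by move=> a0 ma; case: (clipP m a0) => -[-> //]; rewrite ?ler_norml; lra.
Qed.

(** In the variable [s = expR v], the right-hand side is the convex function
    [s ln s - s - m s], whose derivative [ln s - m] vanishes at [s = expR m];
    on an interval it is therefore smallest at the point nearest to [expR m]. *)
Lemma clip_min a m v : `|v| <= a ->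
  expR (clip a m) * (clip a m - 1 - m) <= expR v * (v - 1 - m).
Proof.
set u := clip a m => va; have a0 : 0 <= a by exact: le_trans va.
have h1 : expR v * (1 + (u - v)) <= expR u.
  rewrite -[X in _ <= expR X](subrK v) expRD mulrC ler_wpM2r ?expR_ge0//.
  exact: expR_ge1Dx.
suff : 0 <= (expR v - expR u) * (u - m) by lra.
move: va; rewrite ler_norml /u => /andP[v1 v2].
case: (clipP m a0) => -[-> hm]; last 1 first.
- by apply: mulr_le0; [rewrite subr_le0 ler_expR|lra].
- by apply: mulr_ge0; [rewrite subr_ge0 ler_expR|lra].
- by rewrite subrr mulr0.
Qed.

Lemma expR_dist a u v : u <= a -> v <= a ->
  `|expR u - expR v| <= expR a * `|u - v|.
Proof.
wlog uv : u v / u <= v.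
  move=> h ua va; have [uv|vu] := leP u v; first exact: h.
  by rewrite distrC [X in _ <= _ * X]distrC; apply: h => //; exact: ltW.
move=> ua va.
rewrite !ler0_norm ?subr_le0 ?ler_expR//.
have h1 : expR v * (1 + (u - v)) <= expR u.
  rewrite -[X in _ <= expR X](subrK v) expRD mulrC ler_wpM2r ?expR_ge0//.
  exact: expR_ge1Dx.
have h2 : expR v <= expR a by rewrite ler_expR.
nra.
Qed.

End RealFunctions.

(** * Bounded functions under a probability measure *)
Section Bounded.
Context d (T : measurableType d) (R : realType).
Implicit Types (f g : T -> R).

(** Integrable for every probability measure, so that a kernel acts on such
    functions at every point and not only almost everywhere. *)
Definition bmeas f :=
  measurable_fun [set: T] f /\ exists B : R, forall x, `|f x| <= B.

Lemma bmeas_itv a b f : measurable_fun [set: T] f ->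
  (forall x, a <= f x <= b) -> bmeas f.
Proof.
move=> mf fab; split=> //; exists (`|a| + `|b|) => x.
have /andP[af fb] := fab x; have := ler_norm (- a); have := ler_norm b.
have := normr_ge0 a; have := normr_ge0 b; rewrite normrN ler_norml => *.
by apply/andP; split; lra.
Qed.

Lemma bmeas_cst r : bmeas (cst r : T -> R).
Proof. by split=> //; exists `|r|. Qed.

Lemma bmeasD f g : bmeas f -> bmeas g -> bmeas (fun x => f x + g x).
Proof.
move=> [mf [A fA]] [mg [B gB]]; split; first exact: measurable_funD.
by exists (A + B) => x; rewrite (le_trans (ler_normD _ _))// lerD.
Qed.

Lemma bmeasN f : bmeas f -> bmeas (fun x => - f x).
Proof.
move=> [mf [A fA]]; split; first exact: measurableT_comp.
by exists A => x; rewrite normrN.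
Qed.

Lemma bmeasB f g : bmeas f -> bmeas g -> bmeas (fun x => f x - g x).
Proof. by move=> bf /bmeasN; exact: bmeasD. Qed.

Lemma bmeasM f g : bmeas f -> bmeas g -> bmeas (fun x => f x * g x).
Proof.
move=> [mf [A fA]] [mg [B gB]]; split; first exact: measurable_funM.
by exists (A * B) => x; rewrite normrM ler_pM.
Qed.

Lemma bmeasZ r f : bmeas f -> bmeas (fun x => r * f x).
Proof. exact: (bmeasM (bmeas_cst r)). Qed.

Lemma bmeas_norm f : bmeas f -> bmeas (fun x => `|f x|).
Proof.
move=> [mf [A fA]]; split; first exact: measurableT_comp.
by exists A => x; rewrite normr_id.
Qed.

Lemma bmeas_sum n (F : 'I_n -> T -> R) :
  (forall i, bmeas (F i)) -> bmeas (fun x => \sum_(i < n) F i x).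
Proof.
move=> bF; split; first by apply: measurable_sum => i; exact: (bF i).1.
have /choice[B FB] := fun i => (bF i).2.
by exists (\sum_i B i) => x; rewrite (le_trans (ler_norm_sum _ _ _))// ler_sum.
Qed.

(** Symmetric bounds on the logarithm.  This class is preserved by Markov
    operators, and clipping the logarithm of a function gives one of its
    members. *)
Definition box a f :=
  measurable_fun [set: T] f /\
  forall x, expR (- a) <= f x <= expR a.

Lemma box_bmeas a f : box a f -> bmeas f.
Proof. by move=> [mf]; exact: bmeas_itv. Qed.

Lemma box_gt0 a f x : box a f -> 0 < f x.
Proof. by move=> [_ /(_ x)/andP[+ _]]; exact/lt_le_trans/expR_gt0. Qed.

Lemma box_ln a f : box a f ->
  bmeas (fun x => ln (f x)) /\ forall x, `|ln (f x)| <= a.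
Proof.
move=> bf; suff h x : `|ln (f x)| <= a.
  by split=> //; split; [apply: measurableT_comp => //; exact: bf.1|exists a].
have f0 := box_gt0 x bf; have /andP[h1 h2] := bf.2 x.
by rewrite ler_norml -ler_expR lnK ?posrE// h1 -ler_expR lnK ?posrE.
Qed.

Lemma box_xlnx a f : box a f -> bmeas (fun x => xlnx (f x)).
Proof. by move=> bf; apply: bmeasM; [exact: (box_bmeas bf)|exact: (box_ln bf).1]. Qed.

Section Integral.
Variable mu : {measure set T -> \bar R}.
Hypothesis mu1 : mu setT = 1%E.
Local Notation E f := (\int[mu]_x f x).

Lemma bmeas_int f : bmeas f -> mu.-integrable setT (EFin \o f).
Proof.
move=> [mf [B fB]]; apply: measurable_bounded_integrable => //.
  by rewrite mu1 ltry.
exists B; split; first exact: num_real.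
by move=> M BM x _; apply: le_trans (fB x) _; exact: ltW.
Qed.

Lemma EFin_mean f : bmeas f -> (E f)%:E = (\int[mu]_x (f x)%:E)%E.
Proof.
by move=> bf; rewrite /Rintegral fineK//; exact: (integrable_fin_num _ (bmeas_int bf)).
Qed.

Lemma mean_cst r : E (fun=> r) = r.
Proof. by rewrite Rintegral_cst// mu1 mulr1. Qed.

Lemma mean_le f g : bmeas f -> bmeas g -> (forall x, f x <= g x) -> E f <= E g.
Proof. by move=> bf bg fg; apply: le_Rintegral => //; exact: bmeas_int. Qed.

Lemma meanD f g : bmeas f -> bmeas g -> E (fun x => f x + g x) = E f + E g.
Proof. by move=> bf bg; apply: RintegralD => //; exact: bmeas_int. Qed.

Lemma meanB f g : bmeas f -> bmeas g -> E (fun x => f x - g x) = E f - E g.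
Proof. by move=> bf bg; apply: RintegralB => //; exact: bmeas_int. Qed.

Lemma meanZ r f : bmeas f -> E (fun x => r * f x) = r * E f.
Proof. by move=> bf; apply: RintegralZl => //; exact: bmeas_int. Qed.

Lemma mean_sum n (F : 'I_n -> T -> R) : (forall i, bmeas (F i)) ->
  E (fun x => \sum_(i < n) F i x) = \sum_(i < n) E (F i).
Proof.
elim: n F => [|n IH] F bF.
  by under eq_Rintegral do rewrite big_ord0; rewrite big_ord0 mean_cst.
under eq_Rintegral do rewrite big_ord_recr.
by rewrite big_ord_recr/= meanD ?IH//; exact: bmeas_sum.
Qed.

Lemma mean_norm f : bmeas f -> `|E f| <= E (fun x => `|f x|).
Proof. by move=> bf; apply: le_normr_Rintegral => //; exact: bmeas_int. Qed.

Lemma mean_itv a b f : measurable_fun [set: T] f ->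
  (forall x, a <= f x <= b) -> a <= E f <= b.
Proof.
move=> mf h; have bf := bmeas_itv mf h.
by apply/andP; split; [rewrite -(mean_cst a)|rewrite -(mean_cst b)];
  apply: mean_le => //; try (exact: bmeas_cst); move=> x; have /andP[] := h x.
Qed.

Lemma box_mean a f : box a f -> expR (- a) <= E f <= expR a.
Proof. by move=> [mf fa]; exact: mean_itv. Qed.

(** Jensen's inequality, by integrating the tangent of [xlnx] at the mean. *)
Lemma xlnx_mean_le a f : box a f -> xlnx (E f) <= E (fun x => xlnx (f x)).
Proof.
move=> bf; have b1 := box_bmeas bf; have b2 := box_xlnx bf.
have m0 : 0 < E f.
  by have /andP[+ _] := box_mean bf; exact/lt_le_trans/expR_gt0.
have := @mean_le (fun x => ln (E f) * f x + (f x - E f)) _ _ b2.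
have bc := bmeas_cst (E f).
rewrite meanD ?meanB ?meanZ ?mean_cst// ?subrr ?addr0; last 2 first.
- exact: bmeasZ.
- exact: bmeasB.
rewrite /xlnx mulrC; apply.
  by apply: bmeasD; [exact: bmeasZ|exact: bmeasB].
by move=> x; rewrite mulrC; apply: xlnx_tangent => //; exact/ltW/(box_gt0 x bf).
Qed.

End Integral.

Lemma bmeas_Lfun (P : probability T R) p f : bmeas f -> (1 <= p)%E ->
  f \in Lfun P p.
Proof.
move=> [mf [B fB]] p1.
suff h : f \in Lfun P +oo%E.
  by apply: (@Lfun_subset _ _ _ P p +oo%E) => //; rewrite ?leey ?fin_num_measure.
rewrite inE; apply/andP; split; rewrite inE//=.
rewrite /finite_norm unlock/= probability_setT lte01.
apply: (@le_lt_trans _ _ B%:E); last exact: ltry.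
by apply/ess_supP; apply: aeW => x /=; rewrite lee_fin.
Qed.

End Bounded.

(** * Measure-preserving kernels *)
Section Kernels.
Context d (Omega : measurableType d) (R : realType).
Variable P : probability Omega R.
Implicit Types (f g : Omega -> R) (K : R.-pker Omega ~> Omega).
Local Notation E f := (\int[P]_x f x).

Lemma markov_measurable K f : measurable_fun [set: Omega] f ->
  measurable_fun [set: Omega] (markov_op K f).
Proof.
move=> mf; have mf' : measurable_fun [set: Omega] (EFin \o f).
  exact/measurable_EFinP.
rewrite /markov_op /Rintegral.
apply: (measurableT_comp (fine_measurable measurableT)).
under eq_fun do rewrite integralE.
apply: emeasurable_funB; apply: (@measurable_fun_integral_kernel _ _ _ _ _ K);
  by [move=> U mU; exact: measurable_kernel|exact: measurable_funepos
     |exact: measurable_funeneg|move=> z; exact: funepos_ge0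
     |move=> z; exact: funeneg_ge0].
Qed.

Lemma markov_itv K a b f : measurable_fun [set: Omega] f ->
  (forall x, a <= f x <= b) -> forall x, a <= markov_op K f x <= b.
Proof. by move=> mf fab x; apply: mean_itv => //; exact: prob_kernel. Qed.

Lemma markov_bmeas K f : bmeas f -> bmeas (markov_op K f).
Proof.
move=> [mf [B fB]]; apply: (@bmeas_itv _ _ _ (- B) B).
  exact: markov_measurable.
by apply: markov_itv => // x; rewrite -ler_norml.
Qed.

Definition invariant K := forall f, bmeas f -> E (markov_op K f) = E f.

(** [invariant] is what the kernel and its adjoint have in common: for the
    kernel it is the assumption, for the adjoint the duality with the constant
    [1]. *)
Lemma measure_preserving_invariant K :
  measure_preserving P K -> invariant K.
Proof.
move=> mpK f bf; have := mpK f (bmeas_Lfun P bf (leey _)).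
by rewrite unlock /Rintegral => ->.
Qed.

Lemma adjoint_duality K S f g : is_adjoint P K S -> bmeas f -> bmeas g ->
  E (fun x => markov_op S f x * g x) = E (fun x => f x * markov_op K g x).
Proof.
move=> adj bf bg.
have := adj f g (bmeas_Lfun P bf _) (bmeas_Lfun P bg _).
rewrite unlock /Rintegral => /(_ (lee1n 2) (lee1n 2)) ->.
by congr fine; apply: eq_integral => x _; rewrite mulrC.
Qed.

Lemma adjoint_invariant K S : is_adjoint P K S -> invariant S.
Proof.
move=> adj f bf; have := adjoint_duality adj bf (bmeas_cst _ 1).
have K1 x : markov_op K (cst 1) x = 1.
  by rewrite /markov_op mean_cst//; exact: prob_kernel.
rewrite (_ : (fun x => f x * _) = f); last first.
  by apply/funext => x; rewrite K1 mulr1.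
rewrite (_ : (fun x => _ * cst 1 x) = markov_op S f)//.
by apply/funext => x; rewrite mulr1.
Qed.

Lemma integral_min_lim (mu : {measure set Omega -> \bar R}) f :
  measurable_fun [set: Omega] f -> (forall x, 0 <= f x) ->
  (\int[mu]_x (f x)%:E =
   limn (fun n => \int[mu]_x (Num.min (f x) n%:R)%:E))%E.
Proof.
move=> mf f0; rewrite -monotone_convergence//.
- apply: eq_integral => x _; apply/esym/cvg_lim => //.
  apply: cvg_near_cst; near=> n; rewrite min_l//.
  by near: n; exact: nbhs_infty_ger.
- by move=> n; apply/measurable_EFinP; exact: measurable_minr.
- by move=> n x _; rewrite lee_fin le_min f0 ler0n.
- move=> x _ m n mn; rewrite lee_fin le_min ge_min lexx/= ge_min.
  by rewrite ler_nat mn orbT.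
Unshelve. all: by end_near.
Qed.

(** The identity says that [P] is the law of one step of the kernel started
    from [P]; it passes from the functions [min (f, n)] to [f] by monotone
    convergence, applied under [K x] and then under [P]. *)
Lemma invariant_ge0 K f : invariant K ->
  measurable_fun [set: Omega] f -> (forall x, 0 <= f x) ->
  (\int[P]_x \int[K x]_y (f y)%:E = \int[P]_x (f x)%:E)%E.
Proof.
move=> inv mf f0.
have bmin n : bmeas (fun y => Num.min (f y) n%:R).
  apply: (@bmeas_itv _ _ _ 0 n%:R); first exact: measurable_minr.
  by move=> x; rewrite le_min f0 ler0n ge_min lexx orbT/=.
rewrite [RHS]integral_min_lim//.
under [LHS]eq_integral do rewrite integral_min_lim//.
rewrite monotone_convergence//.
- congr (limn _); apply/funext => n.
  rewrite -EFin_mean//; last exact: probability_setT.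
  rewrite -(inv _ (bmin n)) EFin_mean; last 2 first.
  + exact: probability_setT.
  + exact: markov_bmeas.
  by apply: eq_integral => x _; rewrite -EFin_mean//; exact: prob_kernel.
- move=> n; apply: (@measurable_fun_integral_kernel _ _ _ _ _ K).
  + by move=> U mU; exact: measurable_kernel.
  + by move=> x; rewrite lee_fin le_min f0 ler0n.
  + by apply/measurable_EFinP; exact: (bmin n).1.
- move=> n x _; apply: integral_ge0 => y _.
  by rewrite lee_fin le_min f0 ler0n.
- move=> x _ m n mn; apply: ge0_le_integral => //.
  + by move=> y _; rewrite lee_fin le_min f0 ler0n.
  + by apply/measurable_EFinP; exact: (bmin m).1.
  + by apply/measurable_EFinP; exact: (bmin n).1.
  + move=> y _; rewrite lee_fin le_min ge_min lexx/= ge_min.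
    by rewrite ler_nat mn orbT.
Qed.

Lemma null_eventU N1 N2 :
  null_event P N1 -> null_event P N2 -> null_event P (N1 `|` N2).
Proof.
move=> [mN1 N10] [mN2 N20]; split; first exact: measurableU.
by rewrite null_set_setU.
Qed.

Lemma null_event_common n (Q : 'I_n -> set Omega -> Prop) :
  (forall i N N', Q i N -> N `<=` N' -> Q i N') ->
  (forall i, exists N, null_event P N /\ Q i N) ->
  exists N, null_event P N /\ forall i, Q i N.
Proof.
move=> Qmono /choice[N N0]; exists (\big[setU/set0]_(i < n) N i); split.
  elim/big_ind: _ => [|A B|i _]; last exact: (N0 i).1.
    by split; rewrite ?measure0.
  exact: null_eventU.
move=> i; apply: (Qmono i _ _ (N0 i).2).
by move=> x Nx; rewrite (bigD1 i)//; left.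
Qed.

Lemma ae_null_event (Q : Omega -> Prop) : {ae P, forall x, Q x} ->
  exists N, null_event P N /\ forall x, ~ N x -> Q x.
Proof.
move=> [N [mN N0 NQ]]; exists N; split => // x Nx.
by apply: contrapT => nQ; apply: Nx; exact: NQ.
Qed.

(** Almost every [K x] ignores a given null event, because [P N] is the mean of
    the masses [K x N].  A function that is Lipschitz off a null event can thus
    be evaluated along couplings of [K x] and [K y]. *)
Lemma kernel_null K N : invariant K -> null_event P N ->
  exists N', null_event P N' /\ forall x, ~ N' x -> K x N = 0%E.
Proof.
move=> inv [mN N0]; apply: ae_null_event.
have h : (\int[P]_x (K x N) = 0)%E.
  transitivity (\int[P]_x \int[K x]_y (\1_N y)%:E)%E.
    by apply: eq_integral => x _; rewrite integral_indic// setIT.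
  by rewrite invariant_ge0// integral_indic// setIT.
have mK : measurable_fun [set: Omega] (fun x => K x N) by exact: measurable_kernel.
have /ae_eq_integral_abs : measurable_fun [set: Omega] (fun x => K x N) by [].
move=> /(_ P measurableT)[+ _].
have -> : (\int[P]_x `|K x N| = 0)%E.
  by rewrite -[RHS]h; apply: eq_integral => x _; rewrite gee0_abs.
by move=> /(_ erefl); apply: filterS => x /(_ I).
Qed.

End Kernels.

Lemma mean_ae_le d (T : measurableType d) (R : realType)
  (mu : {measure set T -> \bar R}) (f g : T -> R) : mu setT = 1%E ->
  bmeas f -> bmeas g -> (forall x, 0 <= f x) -> (forall x, 0 <= g x) ->
  {ae mu, forall x, f x <= g x} ->
  \int[mu]_x f x <= \int[mu]_x g x.
Proof.
move=> mu1 bf bg f0 g0 fg; rewrite -lee_fin !EFin_mean//.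
apply: ae_ge0_le_integral => //.
- by move=> x _; rewrite lee_fin.
- by apply/measurable_EFinP; exact: bf.1.
- by move=> x _; rewrite lee_fin.
- by apply/measurable_EFinP; exact: bg.1.
- by apply: filterS fg => x /= fgx _; rewrite lee_fin.
Qed.

(** * Lipschitz functions and couplings *)
Section Couplings.
Context d (R : realType) (Omega : measurableMetricType d R).
Context d' (S : measurableType d') (Q : probability S R).
Implicit Types (X Y : {mfun S >-> Omega}) (mu : {measure set Omega -> \bar R}).

Lemma bmeas_mfun X (f : Omega -> R) : bmeas f -> bmeas (f \o X).
Proof.
by move=> [mf [B fB]]; split; [exact: measurableT_comp|exists B => w /=].
Qed.

Lemma law_integral X mu (f : Omega -> R) : has_law Q X mu -> bmeas f ->
  \int[mu]_y f y = \int[Q]_w f (X w).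
Proof.
move=> lawX bf; congr fine.
rewrite (@eq_measure_integral _ _ _ _ (distribution Q X)); last first.
  by move=> A mA _; apply/esym; exact: lawX.
rewrite integral_distribution//.
  by apply/measurable_EFinP; exact: bf.1.
by apply: bmeas_int; [exact: probability_setT|exact: (@bmeas_mfun X)].
Qed.

Lemma law_null X mu N : has_law Q X mu -> measurable N -> mu N = 0%E ->
  {ae Q, forall w, ~ N (X w)}.
Proof.
move=> lawX mN N0; exists (X @^-1` N); split.
- exact: measurable_funPTI.
- by rewrite -N0 -(lawX _ mN).
- by move=> w /= /contrapT.
Qed.

End Couplings.

Section Lipschitz.
Context d (R : realType) (Omega : measurableMetricType d R).
Variable P : probability Omega R.
Hypothesis mdist_meas : measurable_fun [set: (Omega * Omega)%type]
     (fun z : Omega * Omega => mdist z.1 z.2 : R).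
Implicit Types (f g : Omega -> R) (L : R) (K : R.-pker Omega ~> Omega).
Local Notation E f := (\int[P]_x f x).

(** An admissible constant with its exceptional set, instead of the infimum
    [Lip P f]: the constants below are explicit, and couplings are controlled
    pointwise off one given null event. *)
Definition essLip f L :=
  exists N, null_event P N /\
  forall x y, ~ N x -> ~ N y -> `|f x - f y| <= L * mdist x y.

Lemma mdist_mfun d' (S : measurableType d') (X Y : {mfun S >-> Omega}) :
  measurable_fun [set: S] (fun w => mdist (X w) (Y w) : R).
Proof.
have mXY : measurable_fun [set: S] (fun w => (X w, Y w)).
  by apply/measurable_fun_pairP; split => /=; exact: measurable_funPT.
exact: (measurableT_comp mdist_meas mXY).
Qed.

(** A coupling [(X, Y)] of [K x] and [K y] at distance at most [r] almost surely
    gives [f X <= expR (L * r) * f Y] almost surely, hence in mean.  The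
    multiplicative form is why the distance has to be controlled almost surely,
    that is by [Winfty], and why the Lipschitz constants are those of
    logarithms. *)
Lemma essLip_ln_markov K f a L l : invariant P K -> 0 <= L ->
  measurable_fun [set: Omega] f ->
  (forall x, expR (- a) <= f x <= expR a) ->
  essLip (fun x => ln (f x)) L ->
  (exists N, null_event P N /\ forall x y, ~ N x -> ~ N y ->
     Winfty (K x) (K y) <= (l * mdist x y)%:E)%E ->
  essLip (fun x => ln (markov_op K f x)) (l * L).
Proof.
move=> inv L0 mf fa [N1 [N10 fL]] [N3 [N30 sec]].
have [N2 [N20 KN]] := kernel_null inv N10.
exists (N2 `|` N3); split; first exact: null_eventU.
have bf := bmeas_itv mf fa.
have f0 x : 0 < f x by have /andP[+ _] := fa x; exact/lt_le_trans/expR_gt0.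
have Kf0 x : 0 < markov_op K f x.
  by have /andP[+ _] := markov_itv K mf fa x; exact/lt_le_trans/expR_gt0.
suff main x y : ~ (N2 `|` N3) x -> ~ (N2 `|` N3) y ->
    ln (markov_op K f x) - ln (markov_op K f y) <= l * L * mdist x y.
  move=> x y Nx Ny /=; rewrite ler_norml main// andbT.
  by have := main _ _ Ny Nx; rewrite [mdist y x]metric_sym; lra.
move=> /not_orP[N2x N3x] /not_orP[N2y N3y].
apply/ler_addgt0Pl => e e0; rewrite [l * L]mulrC.
have L1 : 0 < L + 1 by lra.
(* [Winfty] is an infimum, attained up to a positive excess only; this excess
   adds at most [e] to [L * r], including when [L = 0]. *)
pose r := l * mdist x y + e / (L + 1).
have : (Winfty (K x) (K y) < r%:E)%E.
  apply: le_lt_trans (sec _ _ N3x N3y) _; rewrite lte_fin ltrDl.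
  exact: divr_gt0.
move=> /ereal_inf_lt[_ [d' [S [Q [X [Y [lawX lawY ->]]]]]]] /ltW /ess_supP dXY.
have XN := law_null lawX N10.1 (KN _ N2x).
have YN := law_null lawY N10.1 (KN _ N2y).
have h : markov_op K f x <= expR (L * r) * markov_op K f y.
  rewrite /markov_op (law_integral lawX)// (law_integral lawY)//.
  have bX := bmeas_mfun X bf; have bY := bmeas_mfun Y bf.
  rewrite -meanZ//; last exact: probability_setT.
  apply: mean_ae_le => //.
  - exact: probability_setT.
  - exact: bmeasZ.
  - by move=> w; exact: ltW.
  - by move=> w; rewrite mulr_ge0 ?expR_ge0// ltW.
  apply: filterS3 XN YN dXY => w /= NX NY; rewrite lee_fin => dr.
  rewrite -(lnK (f0 (X w))) -(lnK (f0 (Y w))) -expRD ler_expR.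
  have := le_trans (ler_norm _) (fL _ _ NX NY).
  have := ler_wpM2l L0 dr; lra.
have hr : L * r <= L * l * mdist x y + e.
  rewrite /r mulrDr mulrA lerD2l mulrCA ger_pMr//.
  by rewrite ler_pdivrMr//; lra.
rewrite lerBlDr.
apply: (@le_trans _ _ (L * r + ln (markov_op K f y))); last by rewrite lerD2r; lra.
rewrite -ler_expR expRD !lnK// posrE; exact: Kf0.
Qed.

Lemma null_event_neq N : null_event P N -> exists x, ~ N x.
Proof.
move=> [mN N0]; apply: contrapT => /forallNP h.
have NT : N = setT by apply/seteqP; split => // x _; exact: contrapT (h x).
by move: N0; rewrite NT probability_setT => /eqP; rewrite onee_eq0.
Qed.

Lemma W1_ge0 (mu nu : {measure set Omega -> \bar R}) : (0 <= W1 mu nu)%E.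
Proof.
apply: le_ereal_inf_tmp => _ [d' [S [Q [X [Y [_ _ ->]]]]]].
by rewrite unlock; apply: integral_ge0 => w _; rewrite lee_fin mdist_ge0.
Qed.

(** Kantorovich's easy inequality.  For [L = 0] the right-hand side is [0] even
    where [W1] is infinite, so that case needs its own argument: [g] is then
    constant off a null event, and [markov_op K g] takes the same value. *)
Lemma markov_W1 K g L : invariant P K -> bmeas g -> 0 <= L -> essLip g L ->
  exists N, null_event P N /\ forall x y, ~ N x -> ~ N y ->
  (`|markov_op K g x - markov_op K g y|%:E <= L%:E * W1 (K x) (K y))%E.
Proof.
move=> inv bg + [N1 [N10 gL]]; have [N2 [N20 KN]] := kernel_null inv N10.
rewrite le_eqVlt => /predU1P[L0|L0]; exists N2; split => // x y Nx Ny.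
  have [z Nz] := null_event_neq N10.
  have Kg t : ~ N2 t -> markov_op K g t = g z.
    move=> Nt; rewrite -(mean_cst (prob_kernel (s := K) t) (g z)); congr fine.
    apply: ae_eq_integral => //.
      by apply/measurable_EFinP; exact: bg.1.
    exists N1; split; [exact: N10.1|exact: KN|].
    move=> s; apply: contra_notP => Ns _; congr EFin.
    have := gL _ _ Ns Nz; rewrite -L0 mul0r normr_le0 subr_eq0.
    by move/eqP.
  by rewrite !Kg// subrr normr0 -L0 mul0e.
rewrite -lee_pdivrMl//.
apply: le_ereal_inf_tmp => _ [d' [S [Q [X [Y [lawX lawY ->]]]]]].
have XN := law_null lawX N10.1 (KN _ Nx).
have YN := law_null lawY N10.1 (KN _ Ny).
rewrite lee_pdivrMl// unlock /markov_op (law_integral lawX)// (law_integral lawY)//.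
have bX := bmeas_mfun X bg; have bY := bmeas_mfun Y bg.
have Q1 := probability_setT Q.
rewrite -meanB//.
apply: (@le_trans _ _ (\int[Q]_w `|g (X w) - g (Y w)|)%:E).
  by rewrite lee_fin; apply: mean_norm => //; exact: bmeasB.
have mXY := mdist_mfun X Y.
rewrite EFin_mean//; last by apply: bmeas_norm; exact: bmeasB.
rewrite -ge0_integralZl//; last 3 first.
- exact/measurable_EFinP.
- by move=> w _; rewrite lee_fin mdist_ge0.
- by rewrite lee_fin ltW.
apply: ae_ge0_le_integral => //.
- by apply/measurable_EFinP; apply: (bmeas_norm _).1; exact: bmeasB.
- by move=> w _; rewrite mule_ge0// lee_fin ?mdist_ge0 ?ltW.
- by apply/measurable_EFinP; exact: measurable_funM.
- apply: filterS2 XN YN => w NX NY _; rewrite -EFinM lee_fin.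
  exact: gL.
Qed.

(** Only the weighted sum of the [W1] distances is controlled, so the bounds on
    the single kernels are summed as extended reals before they are compared
    with the distance. *)
Lemma essLip_average n (K : 'I_n -> R.-pker Omega ~> Omega)
  (h : 'I_n -> Omega -> R) (theta l : 'I_n -> R) k L :
  (forall i, invariant P (K i)) -> (forall i, bmeas (h i)) ->
  (forall i, 0 <= theta i) -> (forall i, 0 <= l i) -> 0 <= L ->
  (forall i, essLip (h i) (l i * L)) ->
  (exists N, null_event P N /\ forall x y, ~ N x -> ~ N y ->
     \sum_(i < n) (theta i * l i)%:E * W1 (K i x) (K i y)
         <= (k * mdist x y)%:E)%E ->
  essLip (fun x => \sum_(i < n) theta i * markov_op (K i) (h i) x) (k * L).
Proof.
move=> inv bh th0 l0 L0 hL [N1 [N10 avg]].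
have [N2 [N20 KW]] := @null_event_common _ _ _ P n
  (fun i N => forall x y, ~ N x -> ~ N y ->
  (`|markov_op (K i) (h i) x - markov_op (K i) (h i) y|%:E
   <= (l i * L)%:E * W1 (K i x) (K i y))%E)
  (fun i N N' H NN x y Nx Ny => H x y (fun z => Nx (NN _ z)) (fun z => Ny (NN _ z)))
  (fun i => markov_W1 (inv i) (bh i) (mulr_ge0 (l0 i) L0) (hL i)).
exists (N1 `|` N2); split; first exact: null_eventU.
move=> x y /not_orP[N1x N2x] /not_orP[N1y N2y].
rewrite -sumrB.
apply: (le_trans (ler_norm_sum _ _ _)).
rewrite -lee_fin -sumEFin.
apply: (@le_trans _ _ (\sum_(i < n) L%:E * ((theta i * l i)%:E * W1 (K i x) (K i y)))%E).
  apply: lee_sum => i _.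
  rewrite -mulrBr normrM ger0_norm// EFinM.
  apply: (le_trans (lee_wpmul2l _ (KW i _ _ N2x N2y))); first by rewrite lee_fin.
  by rewrite !muleA -!EFinM; apply: lee_wpmul2r; [exact: W1_ge0|rewrite lee_fin; lra].
rewrite -ge0_sume_distrr; last first.
  by move=> i _; rewrite mule_ge0 ?W1_ge0// lee_fin mulr_ge0.
apply: (le_trans (lee_wpmul2l _ (avg _ _ N1x N1y))); first by rewrite lee_fin.
by rewrite -EFinM lee_fin; lra.
Qed.

Lemma Lip_essLip f : (Lip P f < +oo)%E -> exists2 L : R, 0 <= L & essLip f L.
Proof.
move=> /ereal_inf_lt[_ [N N0 <-]].
set s := ereal_sup _ => s_fin.
have s0 : (0 <= maxe 0 s)%E by rewrite le_max lexx.
have sE : maxe 0%E s = (fine (maxe 0%E s))%:E by rewrite fineK// ge0_fin_numE.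
exists (fine (maxe 0%E s)); first exact: fine_ge0.
exists N; split => // x y Nx Ny.
have [->|xy] := eqVneq x y; first by rewrite subrr normr0 mdistxx mulr0.
rewrite -ler_pdivrMr ?mdist_gt0// -lee_fin -sE le_max; apply/orP; right.
apply: ereal_sup_ubound; exists (x, y) => //; split => //; exact/eqP.
Qed.

(** Compare [f x] with [f y] for an independent copy [y] of [x], through the
    point [o]: [mdist x y <= mdist o x + mdist o y], so [C] is twice the mean of
    the distance to [o], finite because [t <= 1 + t ^+ 2]. *)
Lemma essLip_concentration :
  (exists o : Omega, 'E_P[fun x => (mdist o x ^+ 2)%R] < +oo)%E ->
  exists2 C : R, 0 <= C & forall f L, bmeas f -> 0 <= L -> essLip f L ->
    E (fun x => `|f x - E f|) <= L * C.
Proof.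
move=> [ o ]; rewrite unlock => sq.
pose rho x : R := mdist o x.
have mrho : measurable_fun [set: Omega] rho.
  have mo : measurable_fun [set: Omega] (fun x => (o, x)).
    by apply/measurable_fun_pairP; split => /=;
      [exact: measurable_cst|exact: measurable_id].
  exact: (measurableT_comp mdist_meas mo).
have rho0 x : 0 <= rho x by exact: mdist_ge0.
have P1 := probability_setT P.
have irho : P.-integrable setT (EFin \o rho).
  apply/integrableP; split; first exact/measurable_EFinP.
  apply: (@le_lt_trans _ _ (\int[P]_x ((1 : R)%:E + (rho x ^+ 2)%:E))%E).
    apply: ge0_le_integral => //.
    - by apply: measurableT_comp => //; exact/measurable_EFinP.
    - apply: emeasurable_funD => //; apply/measurable_EFinP.
      exact: measurable_funX.
    - by move=> x _; rewrite lee_fin ger0_norm//; have := rho0 x; nra.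
  rewrite ge0_integralD//.
  - rewrite integral_cst// mul1e; apply: lte_add_pinfty => //.
    by rewrite [ltLHS]P1 ltry.
  - by move=> x _; rewrite lee_fin sqr_ge0.
  - by apply/measurable_EFinP; exact: measurable_funX.
pose c := E rho.
have c0 : 0 <= c by exact: Rintegral_ge0.
have icst r : P.-integrable setT (EFin \o (fun=> r)).
  by apply: bmeas_int => //; exact: bmeas_cst.
have iaff r L : P.-integrable setT (EFin \o (fun x => L * (rho x + r))).
  have -> : EFin \o (fun x => L * (rho x + r)) =
     (fun x => L%:E * ((EFin \o rho) x + (EFin \o fun=> r) x))%E by [].
  by apply: integrableZl => //; exact: integrableD.
have Eaff r L : E (fun x => L * (rho x + r)) = L * (c + r).
  rewrite RintegralZl//; last exact: (integrableD measurableT irho (icst r)).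
  by rewrite RintegralD// mean_cst.
have E_affE r L : (\int[P]_x (L * (rho x + r))%:E = (L * (c + r))%:E)%E.
  rewrite -Eaff /Rintegral fineK//; exact: (integrable_fin_num _ (iaff r L)).
exists (c + c); first exact: addr_ge0.
move=> f L bf L0 [N [[mN N0] fL]].
have baff r x : 0 <= r -> (0 <= (L * (rho x + r))%:E)%E.
  by move=> r0; rewrite lee_fin mulr_ge0// addr_ge0.
have maff r : measurable_fun [set: Omega] (fun x => (L * (rho x + r))%:E).
  exact: measurable_int (iaff r L).
have bdev t : bmeas (fun x => `|f x - t|).
  by apply: bmeas_norm; apply: bmeasB => //; exact: bmeas_cst.
have dev x : ~ N x -> `|f x - E f| <= L * (rho x + c).
  move=> Nx; rewrite distrC -{1}(mean_cst P1 (f x)) -meanB//; last exact: bmeas_cst.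
  apply: (le_trans (mean_norm P1 _)); first by apply: bmeasB => //; exact: bmeas_cst.
  rewrite -lee_fin EFin_mean// [rho x + c]addrC -E_affE.
  apply: ae_ge0_le_integral => //.
  - by apply/measurable_EFinP; exact: (bdev _).1.
  - by move=> y _; exact: baff.
  exists N; split => // y; apply: contra_notP => Ny _.
  rewrite lee_fin (le_trans (fL _ _ Ny Nx))// ler_wpM2l//.
  rewrite (le_trans (metric_triangle _ o _))// [mdist y o]metric_sym.
  exact: lexx.
rewrite -lee_fin EFin_mean// -E_affE.
apply: ae_ge0_le_integral => //.
- by apply/measurable_EFinP; exact: (bdev _).1.
- by move=> y _; exact: baff.
exists N; split => // y; apply: contra_notP => Ny _.
by rewrite lee_fin dev.
Qed.

End Lipschitz.

(** * Contraction for bounded densities *)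
Section Contraction.
Context d (R : realType) (Omega : measurableMetricType d R).
Variable P : probability Omega R.
Context (M : nat) (T Tstar : 'I_M -> R.-pker Omega ~> Omega).
Variable theta : 'I_M -> R.
Hypothesis T_inv : forall i, invariant P (T i).
Hypothesis T_adj : forall i, is_adjoint P (T i) (Tstar i).
Hypothesis theta_ge0 : forall i, 0 <= theta i.
Hypothesis theta_sum1 : \sum_(i < M) theta i = 1.
Implicit Types (f g : Omega -> R) (a L lam : R).
Local Notation E f := (\int[P]_x f x).

Let P1 : P setT = 1%E. Proof. exact: probability_setT. Qed.

Let Tstar_inv i : invariant P (Tstar i).
Proof. exact: (adjoint_invariant (T_adj i)). Qed.

(** The entropies after one step, before the subtraction of [xlnx (E f)]; along
    the iteration the mean is constant. *)
Definition output_entropy f :=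
  \sum_(i < M) theta i * E (fun x => xlnx (markov_op (Tstar i) f x)).

Definition logT i f x := ln (markov_op (Tstar i) f x).

(** The derivative of [output_entropy] at [f], up to an additive constant. *)
Definition entropy_grad f x :=
  \sum_(i < M) theta i * markov_op (T i) (logT i f) x.

Lemma box_markov a f i : box a f -> box a (markov_op (Tstar i) f).
Proof.
by move=> [mf fa]; split; [exact: markov_measurable|exact: markov_itv].
Qed.

Lemma bmeas_logT a f i : box a f -> bmeas (logT i f).
Proof. by move=> /(box_markov i)/box_ln[]. Qed.

Lemma bmeas_entropy_grad a f : box a f -> bmeas (entropy_grad f).
Proof.
move=> bf; apply: bmeas_sum => i; apply: bmeasZ; apply: markov_bmeas.
exact: bmeas_logT bf.
Qed.

Lemma entropy_grad_bound a f x : box a f -> `|entropy_grad f x| <= a.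
Proof.
move=> bf; apply: (le_trans (ler_norm_sum _ _ _)).
rewrite -[X in _ <= X]mul1r -theta_sum1 mulr_suml; apply: ler_sum => i _.
rewrite normrM ger0_norm// ler_wpM2l// ler_norml.
have [bl la] := box_ln (box_markov i bf).
by apply: markov_itv => [|y]; [exact: bl.1|rewrite -ler_norml; exact: la].
Qed.

(** Duality moves [T i] from [logT i f] to its adjoint on [g]. *)
Lemma mean_mul_grad a f g : box a f -> bmeas g ->
  E (fun x => g x * entropy_grad f x) =
  \sum_(i < M) theta i * E (fun x => markov_op (Tstar i) g x * logT i f x).
Proof.
move=> bf bg.
have bl i := bmeas_logT i bf.
have bTl i := markov_bmeas (T i) (bl i).
have -> : (fun x => g x * entropy_grad f x) =
    (fun x => \sum_(i < M) theta i * (g x * markov_op (T i) (logT i f) x)).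
  apply/funext => x; rewrite mulr_sumr; apply: eq_bigr => i _.
  by rewrite mulrCA.
rewrite mean_sum//; last by move=> i; apply: bmeasZ; exact: bmeasM.
apply: eq_bigr => i _; rewrite meanZ//; last exact: bmeasM.
by rewrite (adjoint_duality (T_adj i)).
Qed.

(** At [g = f] the tangent touches: the products
    [markov_op (Tstar i) f * logT i f] are [xlnx (markov_op (Tstar i) f)]. *)
Lemma output_entropy_grad a f :
  box a f -> output_entropy f = E (fun x => f x * entropy_grad f x).
Proof. by move=> bf; rewrite (mean_mul_grad bf)//; exact: box_bmeas bf. Qed.

(** [output_entropy] is convex, so it lies above its tangent at [f]; the
    constant terms of the tangent cancel because the means agree. *)
Lemma output_entropy_ge a f g : box a f -> box a g -> E g = E f ->
  E (fun x => g x * entropy_grad f x) <= output_entropy g.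
Proof.
move=> bf bg gf; rewrite (mean_mul_grad bf); last exact: box_bmeas bg.
apply: ler_sum => i _; apply: ler_wpM2l => //.
have bSf := box_markov i bf; have bSg := box_markov i bg.
have b1 := box_bmeas bSf; have b2 := box_bmeas bSg.
have b3 := bmeasM b2 (bmeas_logT i bf).
rewrite -[X in X <= _]addr0.
have <- : E (fun x => markov_op (Tstar i) g x - markov_op (Tstar i) f x) = 0.
  by rewrite meanB// !Tstar_inv ?gf ?subrr//; [exact: box_bmeas bf|exact: box_bmeas bg].
rewrite -meanD//; last exact: bmeasB.
apply: mean_le => //; [|exact: (box_xlnx bSg)|].
  by apply: bmeasD => //; exact: bmeasB.
move=> x; apply: xlnx_tangent; first exact: (box_gt0 _ bSf).
by apply/ltW; exact: (box_gt0 _ bSg).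
Qed.

Section Step.
Variables (a lam : R) (f : Omega -> R).
Hypotheses (a0 : 0 <= a) (lam0 : 0 < lam) (bf : box a f).

(** The density minimising [lam * E (xlnx g) - E (g * entropy_grad f)] among
    those with logarithm in [[- a, a]] and a given mean; [c] is the Lagrange
    multiplier of the mean. *)
Definition clip_step c x :=
  expR (clip a (entropy_grad f x / lam - c)).

Let bclip c : bmeas (fun x => clip a (entropy_grad f x / lam - c)).
Proof.
split; last by exists a => x; exact: clip_bound.
apply: measurable_maxr; first exact: measurable_cst.
apply: measurable_minr; first exact: measurable_cst.
apply: measurable_funB => //; apply: measurable_funM => //.
exact: (bmeas_entropy_grad bf).1.
Qed.

Lemma clip_step_box c : box a (clip_step c).
Proof.
split; first by apply: measurableT_comp => //; exact: (bclip c).1.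
by move=> x; rewrite !ler_expR -ler_norml; exact: clip_bound.
Qed.

(** As [c] goes from [- b] to [b], the clip is active everywhere at both ends
    and the mean goes continuously from [expR a] to [expR (- a)]; the mean of
    [f] is in between. *)
Lemma clip_step_mean : exists c, E (clip_step c) = E f.
Proof.
pose b := a / lam + a.
have b0 : 0 <= b by rewrite addr_ge0 ?divr_ge0 ?(ltW lam0).
have Gb x : `|entropy_grad f x / lam| <= a / lam.
  rewrite normrM (gtr0_norm (x := lam^-1)) ?invr_gt0//.
  by rewrite ler_pM2r ?invr_gt0//; exact: entropy_grad_bound.
have hi : E (clip_step b) = expR (- a).
  rewrite -[RHS](mean_cst P1); apply: eq_Rintegral => x _; rewrite /clip_step clip_lo//.
  by have := Gb x; rewrite ler_norml /b => /andP[]; lra.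
have lo : E (clip_step (- b)) = expR a.
  rewrite -[RHS](mean_cst P1); apply: eq_Rintegral => x _; rewrite /clip_step clip_hi//.
  by have := Gb x; rewrite ler_norml /b => /andP[]; lra.
have lip c c' : `|E (clip_step c) - E (clip_step c')| <= expR a * `|c - c'|.
  have bc := box_bmeas (clip_step_box c); have bc' := box_bmeas (clip_step_box c').
  rewrite -meanB//; apply: (le_trans (mean_norm _ (bmeasB bc bc'))) => //.
  rewrite -[leRHS](mean_cst P1); apply: mean_le => //.
  - by apply: bmeas_norm; exact: bmeasB.
  - exact: bmeas_cst.
  move=> x; apply: (@le_trans _ _ (expR a * `|clip a (entropy_grad f x / lam - c)
      - clip a (entropy_grad f x / lam - c')|)).
    apply: expR_dist.
      by have := clip_bound (entropy_grad f x / lam - c) a0; rewrite ler_norml => /andP[].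
    by have := clip_bound (entropy_grad f x / lam - c') a0; rewrite ler_norml => /andP[].
  rewrite ler_wpM2l ?expR_ge0//; apply: (le_trans (clip_dist _ _ a0)).
  by rewrite [leRHS]distrC (_ : _ - _ - _ = c' - c)//; lra.
have cont : continuous (fun c => E (clip_step c)).
  move=> c; apply/cvgrPdist_lt => e e0; near=> c'.
  apply: (le_lt_trans (lip _ _)).
  rewrite mulrC -ltr_pdivlMr ?expR_gt0//.
  by near: c'; apply: cvgr_dist_lt; [exact: cvg_id|rewrite divr_gt0 ?expR_gt0].
have bb : - b <= b by lra.
have mm : Num.min (E (clip_step (- b))) (E (clip_step b)) <= E f <=
          Num.max (E (clip_step (- b))) (E (clip_step b)).
  by rewrite lo hi; have /andP[h1 h2] := box_mean P1 bf; rewrite ge_min h1 orbT le_max h2.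
by have [c _ <-] := IVT bb (continuous_subspaceT cont) mm; exists c.
Unshelve. all: by end_near.
Qed.

(** The new density minimises [lam * E (xlnx g) - E (g * entropy_grad f)], which
    is an upper bound for [lam * E (xlnx g) - output_entropy g] that is exact at
    [g = f]. *)
Lemma clip_step_decr c : E (clip_step c) = E f ->
  lam * E (fun x => xlnx (clip_step c x)) - output_entropy (clip_step c) <=
  lam * E (fun x => xlnx (f x)) - output_entropy f.
Proof.
move=> Ec; set g := clip_step c; have bg : box a g := clip_step_box c.
have Hg := output_entropy_ge bf bg Ec; rewrite (output_entropy_grad bf).
suff h : lam * E (fun x => xlnx (g x)) - E (fun x => g x * entropy_grad f x)
    <= lam * E (fun x => xlnx (f x)) - E (fun x => f x * entropy_grad f x) by lra.
have bG := bmeas_entropy_grad bf.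
(* The integrand of [clip_min] at [m = entropy_grad f x / lam - c]; its part
   [(c - 1) * h x] has the same mean for [f] and for the new density. *)
pose q h x := xlnx (h x) + ((c - 1) * h x - lam^-1 * (h x * entropy_grad f x)).
have bq h : box a h -> bmeas (q h).
  move=> bh; apply: bmeasD; first exact: (box_xlnx bh).
  have b1 := box_bmeas bh.
  by apply: bmeasB; apply: bmeasZ => //; exact: bmeasM.
have Eq h : box a h -> E (q h) =
    E (fun x => xlnx (h x)) +
    ((c - 1) * E h - lam^-1 * E (fun x => h x * entropy_grad f x)).
  move=> bh; have b1 := box_bmeas bh; have b2 := box_xlnx bh.
  have b3 := bmeasM b1 bG; have b4 := bmeasZ lam^-1 b3; have b5 := bmeasZ (c - 1) b1.
  by rewrite meanD ?meanB ?meanZ//; exact: bmeasB.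
have : E (q g) <= E (q f).
  apply: mean_le => //; [exact: bq|exact: bq|] => x.
  have := clip_min (entropy_grad f x / lam - c) ((box_ln bf).2 x).
  rewrite lnK ?posrE ?(box_gt0 x bf)//.
  by rewrite /q /xlnx /g /clip_step expRK; lra.
rewrite !Eq// Ec => h.
have := ler_wpM2l (ltW lam0) h.
rewrite !mulrDr !mulrN ![lam * (lam^-1 * _)]mulrA divff ?gt_eqF// !mul1r; lra.
Qed.

Lemma clip_step_essLip c L : essLip P (entropy_grad f) L ->
  essLip P (fun x => ln (clip_step c x)) (L / lam).
Proof.
move=> [N [N0 h]]; exists N; split=> // x y Nx Ny.
rewrite /clip_step !expRK; apply: (le_trans (clip_dist _ _ a0)).
rewrite (_ : _ - _ - _ = (entropy_grad f x - entropy_grad f y) / lam); last by lra.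
rewrite normrM (gtr0_norm (x := lam^-1)) ?invr_gt0// mulrAC.
by rewrite ler_pM2r ?invr_gt0//; exact: h.
Qed.

End Step.

Section Limit.
Hypothesis mdist_meas : measurable_fun [set: (Omega * Omega)%type]
     (fun z : Omega * Omega => mdist z.1 z.2 : R).
Hypothesis mdist_sq :
  (exists o : Omega, 'E_P[fun x => (mdist o x ^+ 2)%R] < +oo)%E.
Variables (ell : 'I_M -> R) (kappa : R).
Hypothesis ell_ge0 : forall i, 0 <= ell i.
Hypothesis kappa01 : 0 <= kappa <= 1.
Hypothesis sectional_curvature : forall i, exists N, null_event P N /\
     forall x y, ~ N x -> ~ N y ->
       (Winfty (Tstar i x) (Tstar i y) <= (ell i * mdist x y)%:E)%E.
Hypothesis average_curvature : exists N, null_event P N /\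
     forall x y, ~ N x -> ~ N y ->
       (\sum_(i < M) (theta i * ell i)%:E * W1 (T i x) (T i y)
         <= ((1 - kappa) * mdist x y)%:E)%E.
Hypothesis regularity : forall i f, f \in Lfun P +oo%E ->
     (Lip P (markov_op (T i) f) < +oo)%E.

(** The factor [ell i] lost by [Tstar i] on the logarithm is regained in the
    average curvature bound, where it weights the [W1] distance of [T i]. *)
Lemma entropy_grad_essLip a f L : box a f -> 0 <= L ->
  essLip P (fun x => ln (f x)) L -> essLip P (entropy_grad f) ((1 - kappa) * L).
Proof.
move=> bf L0 fL; apply: (essLip_average mdist_meas (l := ell)) => //.
- by move=> i; exact: (bmeas_logT i bf).
- move=> i.
  exact: (essLip_ln_markov (Tstar_inv i) L0 bf.1 bf.2 fL (sectional_curvature i)).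
Qed.

Lemma entropy_grad_essLip_ex a f : box a f ->
  exists2 L : R, 0 <= L & essLip P (entropy_grad f) L.
Proof.
move=> bf.
have /choice[L hL] i : exists L, 0 <= L /\ essLip P (markov_op (T i) (logT i f)) L.
  have [|L L0 fL] := @Lip_essLip _ _ _ P (markov_op (T i) (logT i f)); last by exists L.
  apply: regularity; apply: bmeas_Lfun; last by rewrite leey.
  exact: (bmeas_logT i bf).
exists (\sum_(i < M) theta i * L i).
  by apply: sumr_ge0 => i _; rewrite mulr_ge0//; exact: (hL i).1.
have [N [N0 NL]] := @null_event_common _ _ _ P M
  (fun i N => forall x y, ~ N x -> ~ N y ->
  `|markov_op (T i) (logT i f) x - markov_op (T i) (logT i f) y| <= L i * mdist x y)
  (fun i N N' H NN x y Nx Ny => H x y (fun z => Nx (NN _ z)) (fun z => Ny (NN _ z)))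
  (fun i => (hL i).2).
exists N; split => // x y Nx Ny; rewrite -sumrB.
apply: (le_trans (ler_norm_sum _ _ _)); rewrite mulr_suml.
apply: ler_sum => i _; rewrite -mulrBr normrM ger0_norm// -mulrA.
by rewrite ler_wpM2l//; exact: NL.
Qed.

(** The bounds on the densities stay the same along the iteration, while the
    Lipschitz constants of the logarithms are multiplied by
    [(1 - kappa) / lam]. *)
Lemma clip_step_iter a lam f L n : 0 <= a -> 0 < lam -> box a f -> 0 <= L ->
  essLip P (fun x => ln (f x)) L ->
  exists g, [/\ box a g, E g = E f,
   lam * E (fun x => xlnx (g x)) - output_entropy g <=
   lam * E (fun x => xlnx (f x)) - output_entropy f
   & essLip P (fun x => ln (g x)) (L * ((1 - kappa) / lam) ^+ n)].
Proof.
move=> a0 lam0 bf L0 fL; elim: n => [|n [g [bg gf Dg gL]]].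
  by exists f; rewrite expr0 mulr1.
have [c Ec] := clip_step_mean a0 lam0 bg.
exists (clip_step a lam g c); split.
- exact: clip_step_box.
- by rewrite Ec.
- by apply: le_trans Dg; exact: clip_step_decr.
- have rho0 : 0 <= (1 - kappa) / lam.
    by apply: divr_ge0; [have /andP[] := kappa01; lra|exact: ltW].
  have -> : L * ((1 - kappa) / lam) ^+ n.+1 =
     (1 - kappa) * (L * ((1 - kappa) / lam) ^+ n) / lam by rewrite exprS; lra.
  apply: clip_step_essLip => //; apply: (entropy_grad_essLip bg) => //.
  by rewrite mulr_ge0// exprn_ge0.
Qed.

(** If [ln f] is [L]-Lipschitz, then [f] is within order [L] of its mean in mean,
    hence so is each [markov_op (Tstar i) f]; and [xlnx s - xlnx m] is, up to a
    part linear in [s - m], at most a constant times [|s - m|] as long as [s]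
    and [m] stay between [expR (- a)] and [expR a]. *)
Lemma output_entropy_le_Lip a :
  exists2 C : R, 0 <= C & forall f L, box a f -> 0 <= L ->
  essLip P (fun x => ln (f x)) L -> output_entropy f - xlnx (E f) <= L * C.
Proof.
have [C C0 hC] := essLip_concentration mdist_meas mdist_sq.
exists (expR a * expR a * expR a * C).
  by rewrite !mulr_ge0 ?expR_ge0.
move=> f L bf L0 fL.
have b1 := box_bmeas bf.
have fL' : essLip P f (expR a * L).
  have [N [N0 h]] := fL; exists N; split => // x y Nx Ny.
  rewrite -[f x]lnK ?posrE ?(box_gt0 x bf)// -[f y]lnK ?posrE ?(box_gt0 y bf)//.
  have la z : ln (f z) <= a by apply: le_trans (ler_norm _) _; exact: (box_ln bf).2.
  apply: (le_trans (expR_dist (la x) (la y))).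
  by rewrite -mulrA ler_wpM2l ?expR_ge0//; exact: h.
have Ef := hC _ _ b1 (mulr_ge0 (expR_ge0 _) L0) fL'.
set m := E f in Ef *.
have /andP[m1 m2] : expR (- a) <= m <= expR a by exact: (box_mean P1).
have m0 : 0 < m by apply: lt_le_trans m1; exact: expR_gt0.
have mi : m^-1 <= expR a.
  by rewrite -[expR a]invrK -expRN lef_pV2 ?posrE ?expR_gt0.
have bc := @bmeas_cst _ Omega R m.
have key i : E (fun x => xlnx (markov_op (Tstar i) f x)) <=
    xlnx m + L * (expR a * expR a * expR a * C).
  have bS := box_markov i bf; have b2 := box_bmeas bS.
  set s := markov_op (Tstar i) f in bS b2 *.
  have b3 : bmeas (fun x => `|s x - m|) by apply: bmeas_norm; exact: bmeasB.
  have b4 : bmeas (fun x => `|f x - m|) by apply: bmeas_norm; exact: bmeasB.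
  have h1 : E (fun x => xlnx (s x)) <=
     E (fun x => ln m * s x + (expR a * expR a) * `|s x - m|).
    apply: mean_le => //; [exact: box_xlnx bS|by apply: bmeasD; exact: bmeasZ|].
    move=> x; have s0 := box_gt0 x bS; have /andP[_ s1] := bS.2 x.
    have lns : ln (s x) <= ln m + m^-1 * `|s x - m|.
      have sm : 0 < s x / m by exact: divr_gt0.
      have := expR_ge1Dx (ln (s x / m)); rewrite lnK ?posrE// ln_div ?posrE//.
      have : m^-1 * (s x - m) <= m^-1 * `|s x - m|.
        by rewrite ler_pM2l ?invr_gt0// ler_norm.
      by rewrite mulrBr mulVf ?gt_eqF// [m^-1 * s x]mulrC; lra.
    rewrite /xlnx; apply: (le_trans (ler_wpM2l (ltW s0) lns)).
    rewrite mulrDr [s x * ln m]mulrC lerD2l mulrA.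
    rewrite ler_wpM2r// ler_pM// ?invr_ge0 ltW//.
  have h2 : E (fun x => `|s x - m|) <= E (fun x => `|f x - m|).
    rewrite -(Tstar_inv i b4); apply: mean_le => //; first exact: markov_bmeas.
    move=> x; have K1 := prob_kernel (s := Tstar i) x.
    rewrite /s /markov_op -{1}(mean_cst K1 m) -meanB//.
    exact: mean_norm (bmeasB b1 bc).
  apply: (le_trans h1).
  have b5 := bmeasZ (ln m) b2; have b6 := bmeasZ (expR a * expR a) b3.
  rewrite meanD// !meanZ// Tstar_inv// -/m /xlnx [ln m * m]mulrC lerD2l.
  have -> : L * (expR a * expR a * expR a * C) =
     (expR a * expR a) * (expR a * L * C) by lra.
  by rewrite ler_wpM2l ?mulr_ge0 ?expR_ge0//; exact: le_trans h2 _.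
rewrite lerBlDl -[leRHS]mul1r -theta_sum1 mulr_suml.
by apply: ler_sum => i _; rewrite ler_wpM2l.
Qed.

(** For [lam > 1 - kappa] in place of [1 - kappa], the excess of the left-hand
    side over the right-hand side increases along the iteration, and after [n]
    further steps it is at most of order [rho ^+ n].  The strict inequality
    gives [lam > 0] and [rho < 1]; then [lam] decreases to [1 - kappa]. *)
Lemma box_contraction a f : box a f ->
  output_entropy f - xlnx (E f) <=
  (1 - kappa) * (E (fun x => xlnx (f x)) - xlnx (E f)).
Proof.
move=> bf.
have a0 : 0 <= a.
  have /andP[h1 h2] := box_mean P1 bf; have := le_trans h1 h2.
  by rewrite ler_expR; lra.
have J := xlnx_mean_le P1 bf.
have main lam : 1 - kappa < lam ->
  output_entropy f - xlnx (E f) <= lam * (E (fun x => xlnx (f x)) - xlnx (E f)).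
  move=> klam; have k0 : 0 <= 1 - kappa by have /andP[] := kappa01; lra.
  have lam0 : 0 < lam by exact: le_lt_trans klam.
  set rho := (1 - kappa) / lam.
  have rho0 : 0 <= rho by apply: divr_ge0 => //; exact: ltW.
  have rho1 : rho < 1 by rewrite ltr_pdivrMr// mul1r.
  have [c Ec] := clip_step_mean a0 lam0 bf.
  have [L0 L00 GL] := entropy_grad_essLip_ex bf.
  have f1L := clip_step_essLip a0 lam0 c GL.
  have b1 := clip_step_box lam a0 bf c; have D1 := clip_step_decr a0 lam0 bf Ec.
  set f1 := clip_step a lam f c in Ec f1L b1 D1.
  set L := L0 / lam in f1L.
  have L_ge0 : 0 <= L by rewrite divr_ge0// ltW.
  have [C C0 hC] := output_entropy_le_Lip a.
  have bnd n : output_entropy f - xlnx (E f) -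
      lam * (E (fun x => xlnx (f x)) - xlnx (E f)) <= L * C * rho ^+ n.
    have [g [bg gf1 Dg gL]] := clip_step_iter n a0 lam0 b1 L_ge0 f1L.
    have := hC g _ bg (mulr_ge0 L_ge0 (exprn_ge0 n rho0)) gL.
    have := xlnx_mean_le P1 bg; rewrite gf1 Ec => Jg.
    have := ler_wpM2l (ltW lam0) Jg.
    rewrite mulrAC; lra.
  rewrite -subr_le0.
  have cv : (fun n => L * C * rho ^+ n) @ \oo --> 0.
    rewrite -[X in _ --> X](mulr0 (L * C)); apply: cvgMr.
    by apply: cvg_expr; rewrite ger0_norm.
  rewrite -(cvg_lim _ cv)//; apply: limr_ge; first by apply/cvg_ex; exists 0.
  exact: nearW.
set D := E (fun x => xlnx (f x)) - xlnx (E f).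
have D0 : 0 <= D by rewrite subr_ge0.
apply/ler_addgt0Pl => e e0.
have D1 : 0 < D + 1 by lra.
have := main (1 - kappa + e / (D + 1)); rewrite ltrDl divr_gt0// => /(_ isT).
move/le_trans; apply; rewrite mulrDl addrC lerD2r -/D.
by rewrite mulrAC -mulrA ger_pMr// ler_pdivrMr//; lra.
Qed.

End Limit.
End Contraction.

(** * From bounded densities to the class L log L *)
Section Truncation.
Context {R : realType}.
Implicit Types (s : R) (n : nat).

Definition trunc n s : R := Num.max (n.+1%:R)^-1 (Num.min s n.+1%:R).

Let e_gt0 n : 0 < n.+1%:R :> R. Proof. by rewrite ltr0n. Qed.
Let e_ge1 n : 1 <= n.+1%:R :> R. Proof. by rewrite ler1n. Qed.
Let ei_le1 n : (n.+1%:R)^-1 <= 1 :> R.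
Proof. by rewrite invf_le1. Qed.

Lemma truncP n s : [\/ trunc n s = (n.+1%:R)^-1, trunc n s = s /\ s <= n.+1%:R
  | trunc n s = n.+1%:R /\ n.+1%:R <= s].
Proof.
rewrite /trunc; have [h|h] := leP s n.+1%:R.
  by case: (leP (n.+1%:R)^-1 s) => _; [apply: Or32|apply: Or31].
apply: Or33; split; last exact: ltW.
by rewrite max_r//; exact: le_trans (ei_le1 n) (e_ge1 n).
Qed.

Lemma trunc_itv n s : (n.+1%:R)^-1 <= trunc n s <= n.+1%:R.
Proof.
rewrite /trunc le_max lexx/= ge_max ge_min lexx orbT andbT.
exact: le_trans (ei_le1 n) (e_ge1 n).
Qed.

Lemma trunc_ge0 n s : 0 <= trunc n s.
Proof. by have /andP[+ _] := trunc_itv n s; apply: le_trans; rewrite invr_ge0. Qed.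

Lemma trunc_le n s : 0 <= s -> trunc n s <= s + 1.
Proof.
move=> s0; case: (truncP n s) => [->|[-> _]|[-> h]].
- by apply: (le_trans (ei_le1 n)); rewrite lerDr.
- by rewrite lerDl.
- by apply: (le_trans h); rewrite lerDl.
Qed.

(** Below [1] the function [xlnx] is between [-1] and [0]; above [1] it
    increases, and there truncation only lowers [s]. *)
Lemma trunc_xlnx n s : 0 <= s -> `|xlnx (trunc n s)| <= 1 + `|xlnx s|.
Proof.
move=> s0; rewrite ler_norml; apply/andP; split.
  apply: (@le_trans _ _ (-1)); first by rewrite lerN2 lerDl.
  exact/xlnx_ge/trunc_ge0.
case: (truncP n s) => [->|[-> _]|[-> h]].
- apply: (@le_trans _ _ 0); last by rewrite addr_ge0.
  by rewrite /xlnx mulr_ge0_le0 ?invr_ge0 ?ln_le0.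
- by apply: (le_trans (ler_norm _)); rewrite lerDr.
- apply: (@le_trans _ _ (xlnx s)).
    by rewrite /xlnx ler_pM ?ln_ge0 ?ler_ln ?posrE//; exact: lt_le_trans h.
  by apply: (le_trans (ler_norm _)); rewrite lerDr.
Qed.

Lemma trunc_cvg s : 0 <= s -> trunc n s @[n --> \oo] --> s.
Proof.
move=> s0.
apply: (squeeze_cvgr (f := cst s) (h := fun n => s + (n.+1%:R)^-1)).
- near=> n; have sn : s <= n.+1%:R.
    apply: (@le_trans _ _ n%:R); last by rewrite ler_nat.
    by near: n; exact: nbhs_infty_ger.
  rewrite /trunc min_l// le_max lexx orbT/= ge_max lerDr s0/= lerDl invr_ge0.
  exact: ltW.
- exact: cvg_cst.
- by rewrite -[X in _ --> X]addr0; apply: cvgD; [exact: cvg_cst|exact: cvg_harmonic].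
Unshelve. all: by end_near.
Qed.

End Truncation.

Lemma mean_dominated_cvg d (T : measurableType d) (R : realType)
  (mu : {measure set T -> \bar R}) (u : nat -> T -> R) (v : T -> R)
  (g : T -> \bar R) :
  (forall n, measurable_fun [set: T] (u n)) -> measurable_fun [set: T] v ->
  {ae mu, forall x, u ^~ x @ \oo --> v x} ->
  mu.-integrable setT g -> (forall n x, `|u n x|%:E <= g x)%E ->
  mu.-integrable setT (EFin \o v) /\
  \int[mu]_x u n x @[n --> \oo] --> \int[mu]_x v x.
Proof.
move=> mu_ mv uv ig ug.
have iu n : mu.-integrable setT (EFin \o u n).
  apply: (le_integrable measurableT _ _ ig); first exact/measurable_EFinP.
  by move=> x _ /=; apply: (le_trans (ug n x)); rewrite lee_abs.
have mE n : measurable_fun [set: T] (EFin \o u n) by exact/measurable_EFinP.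
have mvE : measurable_fun [set: T] (EFin \o v) by exact/measurable_EFinP.
have [||iv _ cv] := dominated_convergence measurableT mE mvE _ ig _.
- apply: filterS uv => x ux _; apply/fine_cvgP; split; last exact: ux.
  exact: nearW.
- by apply: aeW => x n _; exact: ug.
split=> //; apply: fine_cvg.
have <- : (\int[mu]_x (v x)%:E)%E = (\int[mu]_x v x)%:E.
  by rewrite /Rintegral fineK//; exact: (integrable_fin_num _ iv).
exact: cv.
Qed.

Section LlogL.
Context d (R : realType) (Omega : measurableType d).
Variable P : probability Omega R.
Implicit Types (f : Omega -> R).
Local Notation E f := (\int[P]_x f x).

Definition truncf n f : Omega -> R := fun x => trunc n (f x).

Lemma truncf_box n f : measurable_fun [set: Omega] f ->
  box (ln n.+1%:R) (truncf n f).
Proof.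
move=> mf; split.
  apply: measurable_maxr; first exact: measurable_cst.
  by apply: measurable_minr => //; exact: measurable_cst.
by move=> x; rewrite expRN lnK ?posrE ?ltr0n//; exact: trunc_itv.
Qed.

(** This majorant serves for [xlnx (f x)] and its truncations, and also for
    those of [f], since [f x <= 1 + xlnx (f x)]. *)
Lemma LlogL_majorant f : LlogL P f ->
  P.-integrable setT (fun x => (2 + `|xlnx (f x)|)%:E).
Proof.
move=> [mf f0]; rewrite unlock => fin.
have mx : measurable_fun [set: Omega] (fun x => xlnx (f x)).
  by apply: measurable_funM => //; exact: measurableT_comp.
have ix : P.-integrable setT (EFin \o (fun x => xlnx (f x))).
  by apply/integrableP; split; [exact/measurable_EFinP|].
apply: (integrableD measurableT (f := fun=> 2%:E) (g := fun x => (`|xlnx (f x)|)%:E)).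
  by apply: (bmeas_int (probability_setT P)); exact: bmeas_cst.
exact: integrable_abse ix.
Qed.

Lemma LlogL_cvg f : LlogL P f ->
  [/\ P.-integrable setT (EFin \o f),
   P.-integrable setT (EFin \o (fun x => xlnx (f x))),
   E (truncf n f) @[n --> \oo] --> E f
   & E (fun x => xlnx (truncf n f x)) @[n --> \oo] --> E (fun x => xlnx (f x))].
Proof.
move=> Lf; have ig := LlogL_majorant Lf; have [mf f0 _] := Lf.
have b n := truncf_box n mf.
have mx : measurable_fun [set: Omega] (fun x => xlnx (f x)).
  by apply: measurable_funM => //; exact: measurableT_comp.
have tf x : truncf n f x @[n --> \oo] --> f x by exact: trunc_cvg.
have ub1 n x : (`|truncf n f x|%:E <= (2 + `|xlnx (f x)|)%:E)%E.
  rewrite lee_fin ger0_norm ?trunc_ge0//.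
  apply: (le_trans (trunc_le n (f0 x))).
  have := xlnx_tangent ltr01 (f0 x); rewrite ln1 mulr0.
  by have := ler_norm (xlnx (f x)); lra.
have ub2 n x : (`|xlnx (truncf n f x)|%:E <= (2 + `|xlnx (f x)|)%:E)%E.
  by rewrite lee_fin; apply: (le_trans (trunc_xlnx n (f0 x))); lra.
have [i1 c1] := mean_dominated_cvg (fun n => (b n).1) mf (aeW _ tf) ig ub1.
have tx x : xlnx (truncf n f x) @[n --> \oo] --> xlnx (f x).
  by apply: (xlnx_cvg (fun n => trunc_ge0 n (f x))); exact: trunc_cvg.
have [i2 c2] := mean_dominated_cvg (fun n => (box_xlnx (b n)).1) mx (aeW _ tx) ig ub2.
by split.
Qed.

(** Dominated convergence twice: under [S x], for almost every [x], to obtain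
    the pointwise convergence of the truncated images, then under [P] with
    majorant [W = S (2 + |xlnx f|)].  [W] is integrable because [S] preserves
    [P], and Jensen's inequality under [S x] bounds [xlnx] of the truncated
    image by [W]. *)
Lemma LlogL_markov_cvg (S : R.-pker Omega ~> Omega) f :
  invariant P S -> LlogL P f ->
  let Sf := markov_op S f in
  [/\ P.-integrable setT (EFin \o Sf),
   P.-integrable setT (EFin \o (fun x => xlnx (Sf x))),
   E Sf = E f
   & E (fun x => xlnx (markov_op S (truncf n f) x)) @[n --> \oo] -->
     E (fun x => xlnx (Sf x))].
Proof.
move=> inv Lf Sf; have ig := LlogL_majorant Lf; have [mf f0 _] := Lf.
have [_ _ cE _] := LlogL_cvg Lf.
have b n := truncf_box n mf.
pose g y : R := 2 + `|xlnx (f y)|.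
have mg : measurable_fun [set: Omega] g.
  by apply/measurable_EFinP; exact: measurable_int ig.
have g0 y : 0 <= g y by rewrite addr_ge0.
pose W x := (\int[S x]_y (g y)%:E)%E.
have W0 x : (0 <= W x)%E by apply: integral_ge0 => y _; rewrite lee_fin.
have mW : measurable_fun [set: Omega] W.
  apply: (@measurable_fun_integral_kernel _ _ _ _ _ S).
  + by move=> U mU; exact: measurable_kernel.
  + by move=> x; rewrite lee_fin.
  + exact/measurable_EFinP.
have iW : P.-integrable setT W.
  apply/integrableP; split => //.
  under eq_integral do rewrite gee0_abs//.
  rewrite /W invariant_ge0//.
  have /integrableP[_] := ig.
  by under eq_integral do rewrite gee0_abs ?lee_fin//.
have igS : {ae P, forall x, (S x).-integrable setT (EFin \o g)}.
  have := integrable_ae measurableT iW; apply: filterS => x /(_ I) Wx.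
  apply/integrableP; split; first exact/measurable_EFinP.
  have -> : (\int[S x]_y `|(EFin \o g) y| = W x)%E.
    by apply: eq_integral => y _; rewrite gee0_abs// lee_fin.
  by rewrite -ge0_fin_numE.
have le1 n y : `|truncf n f y| <= g y.
  rewrite ger0_norm ?trunc_ge0//.
  apply: (le_trans (trunc_le n (f0 y))).
  have := xlnx_tangent ltr01 (f0 y); rewrite ln1 mulr0 /g.
  by have := ler_norm (xlnx (f y)); lra.
have cS : {ae P, forall x, markov_op S (truncf n f) x @[n --> \oo] --> Sf x}.
  apply: filterS igS => x igx.
  have tf y : truncf n f y @[n --> \oo] --> f y by exact: trunc_cvg.
  have ub n y : (`|truncf n f y|%:E <= (g y)%:E)%E by rewrite lee_fin le1.
  by have [] := mean_dominated_cvg (fun n => (b n).1) mf (aeW _ tf) igx ub.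
have mS n : measurable_fun [set: Omega] (markov_op S (truncf n f)).
  exact: markov_measurable (b n).1.
have mSf : measurable_fun [set: Omega] Sf by exact: markov_measurable.
have domW x (h : Omega -> R) : bmeas h -> (forall y, 0 <= h y) ->
   (forall y, h y <= g y) -> ((markov_op S h x)%:E <= W x)%E.
  move=> bh h0 hg; rewrite EFin_mean//; last exact: prob_kernel.
  apply: ge0_le_integral => //.
  - by move=> y _; rewrite lee_fin.
  - by apply/measurable_EFinP; exact: bh.1.
  - exact/measurable_EFinP.
  - by move=> y _; rewrite lee_fin.
have S0 n x : 0 <= markov_op S (truncf n f) x.
  by apply: Rintegral_ge0 => y _; exact: trunc_ge0.
have ub1 n x : (`|markov_op S (truncf n f) x|%:E <= W x)%E.
  rewrite ger0_norm//; apply: domW => //.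
  - exact: box_bmeas (b n).
  - by move=> y; exact: trunc_ge0.
  - by move=> y; apply: le_trans (le1 n y); exact: ler_norm.
have [i1 c1] := mean_dominated_cvg mS mSf cS iW ub1.
have ESf : E Sf = E f.
  rewrite -(cvg_lim _ c1)// -(cvg_lim _ cE)//; congr (limn _).
  by apply/funext => n; rewrite inv//; exact: box_bmeas (b n).
have mxS n : measurable_fun [set: Omega] (fun x => xlnx (markov_op S (truncf n f) x)).
  by apply: measurable_funM => //; exact: measurableT_comp.
have mxSf : measurable_fun [set: Omega] (fun x => xlnx (Sf x)).
  by apply: measurable_funM => //; exact: measurableT_comp.
have cxS : {ae P, forall x,
    xlnx (markov_op S (truncf n f) x) @[n --> \oo] --> xlnx (Sf x)}.
  by apply: filterS cS => x cx; exact: (xlnx_cvg (fun n => S0 n x)).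
have ub2 n x : (`|xlnx (markov_op S (truncf n f) x)|%:E <= W x)%E.
  have W1 : (1%:E <= W x)%E.
    have -> : 1%:E = (markov_op S (cst 1) x)%:E.
      by congr EFin; rewrite /markov_op mean_cst//; exact: prob_kernel.
    apply: domW => //; first exact: bmeas_cst.
    by move=> y; rewrite /g/=; have := normr_ge0 (xlnx (f y)); lra.
  have up : ((xlnx (markov_op S (truncf n f) x))%:E <= W x)%E.
    apply: (@le_trans _ _ (markov_op S (fun y => `|xlnx (truncf n f y)|) x)%:E).
      have bx := box_xlnx (b n); have K1 := prob_kernel (s := S) x.
      rewrite lee_fin; apply: (le_trans (xlnx_mean_le K1 (b n))).
      by apply: (mean_le K1) => //; [exact: bmeas_norm|move=> y; exact: ler_norm].
    apply: domW => //; first exact/bmeas_norm/(box_xlnx (b n)).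
    move=> y; apply: (le_trans (trunc_xlnx n (f0 y))); rewrite /g; lra.
  have lo := xlnx_ge (S0 n x).
  have [h|h] := ler0P (xlnx (markov_op S (truncf n f) x)); last exact: up.
  by apply: le_trans W1; rewrite lee_fin; lra.
have [i2 c2] := mean_dominated_cvg mxS mxSf cxS iW ub2.
by split.
Qed.

End LlogL.

Lemma EntE d (Omega : measurableType d) (R : realType)
  (P : probability Omega R) (f : Omega -> R) :
  P.-integrable setT (EFin \o f) ->
  P.-integrable setT (EFin \o (fun x => xlnx (f x))) ->
  Ent P f = (\int[P]_x xlnx (f x) - xlnx (\int[P]_x f x))%:E.
Proof.
move=> i1 i2; rewrite /Ent unlock EFinB; congr (_ - _)%E.
by rewrite /Rintegral fineK//; exact: (integrable_fin_num _ i2).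
Qed.

Local Open Scope ereal_scope.

Theorem theorem2 (R : realType) (d : measure_display)
  (Omega : measurableMetricType d R) (P : probability Omega R)
  (mdist_meas : measurable_fun [set: (Omega * Omega)%type]
     (fun z : Omega * Omega => mdist z.1 z.2 : R))
  (mdist_sq : exists o : Omega, 'E_P[fun x => (mdist o x ^+ 2)%R] < +oo)
  (M : nat) (M_ge1 : (1 <= M)%N)
  (T Tstar : 'I_M -> R.-pker Omega ~> Omega)
  (T_mp : forall i, measure_preserving P (T i))
  (T_adj : forall i, is_adjoint P (T i) (Tstar i))
  (theta : 'I_M -> R) (theta_ge0 : forall i, (0 <= theta i)%R)
  (theta_sum1 : (\sum_(i < M) theta i = 1)%R)
  (ell : 'I_M -> R) (ell_ge0 : forall i, (0 <= ell i)%R)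
  (kappa : R) (kappa01 : (0 <= kappa <= 1)%R)
  (sectional_curvature : forall i, exists N, null_event P N /\
     forall x y, ~ N x -> ~ N y ->
       Winfty (Tstar i x) (Tstar i y) <= (ell i * mdist x y)%:E)
  (average_curvature : exists N, null_event P N /\
     forall x y, ~ N x -> ~ N y ->
       \sum_(i < M) (theta i * ell i)%:E * W1 (T i x) (T i y)
         <= ((1 - kappa) * mdist x y)%:E)
  (regularity : forall i f, f \in Lfun P +oo ->
     Lip P (markov_op (T i) f) < +oo) :
  forall f, LlogL P f ->
    \sum_(i < M) (theta i)%:E * Ent P (markov_op (Tstar i) f)
      <= (1 - kappa)%:E * Ent P f.
Proof.
move=> f Lf.
have T_inv i : invariant P (T i).
  exact: measure_preserving_invariant.
have S_inv i : invariant P (Tstar i) by exact: adjoint_invariant (T_adj i).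
have [i1 i2 cm cx] := LlogL_cvg Lf.
have H i := LlogL_markov_cvg (S_inv i) Lf.
have EntS i : Ent P (markov_op (Tstar i) f) =
    (\int[P]_x xlnx (markov_op (Tstar i) f x) - xlnx (\int[P]_x f x))%:E%R.
  by have [j1 j2 <- _] := H i; exact: EntE.
under eq_bigr do rewrite EntS -EFinM.
rewrite sumEFin EntE// -EFinM lee_fin.
set m := (\int[P]_x f x)%R in cm *.
rewrite (_ : (\sum_(i < M) _ = \sum_(i < M) theta i *
    (\int[P]_x xlnx (markov_op (Tstar i) f x)) - xlnx m)%R); last first.
  under eq_bigr do rewrite mulrBr.
  by rewrite sumrB -mulr_suml theta_sum1 mul1r.
have cxm : xlnx (\int[P]_x truncf n f x)%R @[n --> \oo] --> xlnx m.
  apply: (xlnx_cvg _ cm) => n; apply: Rintegral_ge0 => x _; exact: trunc_ge0.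
have cl : (output_entropy P Tstar theta (truncf n f) - xlnx (\int[P]_x truncf n f x))%R
   @[n --> \oo] --> (\sum_(i < M) theta i *
    (\int[P]_x xlnx (markov_op (Tstar i) f x)) - xlnx m)%R.
  apply: cvgB => //; rewrite /output_entropy.
  apply: cvg_big; first exact: add_continuous.
  by move=> i _; apply: cvgMr; have [] := H i.
have cr : ((1 - kappa) * (\int[P]_x xlnx (truncf n f x) -
    xlnx (\int[P]_x truncf n f x)))%R
   @[n --> \oo] --> ((1 - kappa) * (\int[P]_x xlnx (f x) - xlnx m))%R.
  by apply: cvgMr; exact: cvgB.
rewrite -(cvg_lim _ cl)// -(cvg_lim _ cr)//.
apply: ler_lim; [exact: cvgP cl|exact: cvgP cr|].
apply: nearW => n; have [mf _ _] := Lf.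
exact: (box_contraction T_inv T_adj theta_ge0 theta_sum1 mdist_meas mdist_sq
  ell_ge0 kappa01 sectional_curvature average_curvature regularity (truncf_box n mf)).
Qed.
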